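(* Let $G$ be a finite, undirected, simple graph on $n\geq 1$ vertices. Then, for any real $\lambda>0$, $$V_G(\lambda)\;\geq\; V_{K_n}(\lambda)=\frac{\lambda}{(1+n\lambda)^2},$$ with equality if and only if $G\cong K_n$.
   Context: All graphs are finite, undirected and simple, with at least one vertex. $K_m$ denotes the complete graph on $m$ vertices. For a graph $G$ on $n$ vertices, $\mathcal{I}(G)$ is the set of all independent sets of $G$ (including the empty set), and the independence polynomial (partition function of the hard-core model) is $P_G(\lambda)=\sum_{I\in\mathcal{I}(G)}\lambda^{|I|}$ for $\lambda>0$. The hard-core model on $G$ at fugacity $\lambda$ is the probability measure on $\mathcal{I}(G)$ given by $\Pr[I]=\lambda^{|I|}/P_G(\lambda)$. The free energy density is $F_G(\lambda)=\frac1n\log P_G(\lambda)$, the occupancy fraction is $E_G(\lambda)=\lambda\frac{\partial}{\partial\lambda}F_G(\lambda)$, and the variance fraction is $V_G(\lambda)=\lambda\frac{\partial}{\partial\lambda}E_G(\lambda)$. Equivalently, $nE_G(\lambda)=\mathbb{E}(|I|)$ and $nV_G(\lambda)=\operatorname{Var}(|I|)$, where $I$ is drawn from the hard-core model on $G$ at fugacity $\lambda$. *)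

(* Defs.v *)
From HB Require Import structures.
From mathcomp Require Import all_boot all_order all_algebra.
From mathcomp Require Import all_classical all_reals all_analysis.

Set Implicit Arguments.
Unset Strict Implicit.
Unset Printing Implicit Defensive.

Import Order.TTheory GRing.Theory Num.Theory.
Import numFieldNormedType.Exports.

Local Open Scope ring_scope.

Record sgraph := SGraph {
  vertex :> finType;
  adj : rel vertex;
  adj_sym : symmetric adj;
  adj_irr : irreflexive adj }.

Definition isomorphic (G H : sgraph) : Prop :=
  exists f : G -> H,
    bijective f /\ forall x y : G, adj (f x) (f y) = adj x y.

Definition complete_rel (n : nat) : rel 'I_n := fun x y => x != y.

Lemma complete_sym n : symmetric (@complete_rel n).
Proof. by move=> x y; rewrite /complete_rel eq_sym. Qed.

Lemma complete_irr n : irreflexive (@complete_rel n).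
Proof. by move=> x; rewrite /complete_rel eqxx. Qed.

Definition complete_graph (n : nat) : sgraph :=
  SGraph (@complete_sym n) (@complete_irr n).

Definition independent (G : sgraph) (I : {set G}) : bool :=
  [forall x in I, forall y in I, ~~ adj x y].

Section HardCore.
Variables (R : realType) (G : sgraph).

Definition independence_poly (lam : R) : R :=
  \sum_(I : {set G} | independent I) lam ^+ #|I|.

Definition free_energy_density (lam : R) : R :=
  (#|G|%:R)^-1 * ln (independence_poly lam).

(* [f^`()] is total on [R -> R]; the functions below are only meaningful at
   [0 < lam], where [independence_poly] is positive and the derivatives exist. *)
Definition occupancy_fraction (lam : R) : R :=
  lam * (free_energy_density^`())%classic lam.

Definition variance_fraction (lam : R) : R :=
  lam * (occupancy_fraction^`())%classic lam.

End HardCore.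

(* Main.v *)
(** Let [X] be the size of a hard-core random independent set [I] and [U] the
    number of vertices that can be added to [I].  Moving a vertex in or out of
    [I] gives [E X = lam E U] and [E (X (X - 1)) = lam E (U X)], so
    [Y = X - lam U] is centred, [E (X Y) = E X], and since [U <= n],
    [E Y^2 = E X - lam E (X U) + lam^2 E U^2 <= (1 + n lam) E X].
    Cauchy-Schwarz for [X] and [Y] then yields [Var X >= E X / (1 + n lam)].
    Finally [E X >= Pr (X >= 1) = 1 - 1 / P_G(lam)], where
    [P_G(lam) >= 1 + n lam] with equality exactly for the complete graph. *)

Require Import Defs.
From HB Require Import structures.
From mathcomp Require Import all_boot all_order all_algebra.
From mathcomp Require Import all_classical all_reals all_analysis.
From mathcomp Require Import ring lra.

Set Implicit Arguments.
Unset Strict Implicit.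
Unset Printing Implicit Defensive.

Import Order.TTheory GRing.Theory Num.Theory.
Import numFieldNormedType.Exports.

Local Open Scope ring_scope.

(** * Independent sets and complete graphs *)

Section IndependentSets.
Variable G : sgraph.
Implicit Types (I J : {set G}) (v : G).

(** Membership is excluded explicitly because [v |: I] is [I] when [v] lies in [I]. Its cardinality
    is the [U] of the overview. *)
Definition addable I : {set G} :=
  [set v | (v \notin I) && independent (v |: I)].

Lemma independent_sub I J : I \subset J -> independent J -> independent I.
Proof.
move=> /fintype.subsetP sIJ /forall_inP iJ; apply/forall_inP => x /sIJ /iJ /forall_inP xJ.
by apply/forall_inP => y /sIJ /xJ.
Qed.

Lemma independent_small I : (#|I| <= 1)%N -> independent I.
Proof.
move=> /card_le1_eqP I1; apply/forall_inP => x xI; apply/forall_inP => y yI.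
by rewrite (I1 x y) // adj_irr.
Qed.

Lemma independent_pair (x y : G) :
  ~~ adj x y -> independent [set x; y].
Proof.
move=> nxy; apply/forall_inP => a; rewrite !inE => /orP[] /eqP->;
  apply/forall_inP => b; rewrite !inE => /orP[] /eqP->;
  by rewrite ?adj_irr // adj_sym.
Qed.

(** Injections preserve [!=], so for a graph with this adjacency any enumeration of the vertices is
    an isomorphism. *)
Lemma isomorphic_completeP n : #|G| = n ->
  isomorphic G (complete_graph n) <-> forall x y : G, adj x y = (x != y).
Proof.
move=> Gn; split=> [[f [/bij_inj f_inj fE]] x y|Gcomplete].
  by rewrite -fE /= /complete_rel inj_eq.
exists (fun x : G => cast_ord Gn (enum_rank x)); split=> [|x y].
  exists (fun i : 'I_n => enum_val (cast_ord (esym Gn) i)) => [x|i].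
    by rewrite cast_ordK enum_rankK.
  by rewrite enum_valK cast_ordKV.
by rewrite /= /complete_rel (inj_eq (@cast_ord_inj _ _ _)) (inj_eq enum_rank_inj) Gcomplete.
Qed.

End IndependentSets.

(** * Unnormalised expectations under the hard-core weights *)

Section HardCoreMoments.
Variables (R : realType) (G : sgraph).
Implicit Types (I : {set G}) (lam : R).

(** This is [P_G(lam)] times the expectation of [f]; leaving it unnormalised avoids divisions in the
    moment identities. *)
Definition hard_core_sum lam (f : {set G} -> R) : R :=
  \sum_(I : {set G} | independent I) lam ^+ #|I| * f I.

Local Notation S := hard_core_sum.

Lemma hard_core_sumD lam f g :
  S lam (fun I => f I + g I) = S lam f + S lam g.
Proof. by rewrite /S -big_split; apply: eq_bigr => I _; rewrite mulrDr. Qed.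

Lemma hard_core_sumZ lam c f : S lam (fun I => c * f I) = c * S lam f.
Proof. by rewrite /S mulr_sumr; apply: eq_bigr => I _; rewrite mulrCA. Qed.

Lemma ler_hard_core_sum lam f g : 0 < lam -> (forall I, f I <= g I) ->
  S lam f <= S lam g.
Proof.
move=> lam0 fg; apply: ler_sum => I _.
by rewrite ler_wpM2l // exprn_ge0 // ltW.
Qed.

Lemma hard_core_sum_ge0 lam f : 0 < lam -> (forall I, 0 <= f I) -> 0 <= S lam f.
Proof.
by move=> lam0 f0; apply: sumr_ge0 => I _; rewrite mulr_ge0 // exprn_ge0 // ltW.
Qed.

Lemma hard_core_sum_one lam : S lam (fun=> 1) = independence_poly G lam.
Proof. by apply: eq_bigr => I _; rewrite mulr1. Qed.

(* The bijection [I |-> v |: I] from sets to which [v] is addable onto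
   independent sets containing [v]. *)
Lemma hard_core_sum_switch lam (g : nat -> R) :
  S lam (fun I => #|I|%:R * g #|I|)
  = lam * S lam (fun I => #|addable I|%:R * g #|I|.+1).
Proof.
have cardE (A : {set G}) : #|A|%:R = \sum_v (v \in A)%:R :> R.
  by rewrite -sum1_card natr_sum big_mkcond; apply: eq_bigr => v _; case: ifP.
pose h (I : {set G}) := lam ^+ #|I| * g #|I|.
(* Double counting of pairs [v \in I] reduces the identity to a fixed [v]. *)
transitivity (\sum_(v : G) \sum_(I : {set G} | independent I && (v \in I)) h I).
  rewrite /S (exchange_big_dep (fun I : {set G} => independent I)) /=; last first.
    by move=> v I _ /andP[].
  apply: eq_bigr => I indI; rewrite cardE mulrCA mulr_suml.
  rewrite [RHS]big_mkcond; apply: eq_bigr => v _; rewrite indI /=.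
  by case: (v \in I); rewrite ?mul1r ?mul0r.
rewrite -hard_core_sumZ /S.
under [RHS]eq_bigr => I _ do rewrite cardE mulr_suml mulr_sumr mulr_sumr.
rewrite exchange_big; apply: eq_bigr => v _ /=.
rewrite (reindex_onto (fun I : {set G} => v |: I) (fun I => I :\ v)) /=; last first.
  by move=> I /andP[_ vI]; rewrite finset.setD1K.
rewrite big_mkcond [RHS]big_mkcond; apply: eq_bigr => I _.
rewrite finset.setU11 andbT inE /h.
have [vI|vI] /= := boolP (v \in I).
  (* Sets already containing [v] are not of the form [J :\ v], and [v] is not addable to them: both
     sides vanish. *)
  have -> : ((v |: I) :\ v == I) = false.
    by apply/negbTE/eqP => /setP/(_ v); rewrite !inE eqxx vI.
  by rewrite andbF !mul0r !mulr0; case: ifP.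
rewrite finset.setU1K // eqxx andbT cardsU1 vI add1n exprS.
have [ivI|] := boolP (independent _); last by rewrite !mul0r !mulr0; case: ifP.
by rewrite (independent_sub (subsetU1 v I) ivI) /= mul1r; ring.
Qed.

(** * Generating polynomials and the contribution of small sets *)

Definition hard_core_poly (f : {set G} -> R) : {poly R} :=
  \sum_(I : {set G} | independent I) f I *: 'X^#|I|.

Lemma horner_hard_core_poly lam f : (hard_core_poly f).[lam] = S lam f.
Proof.
by rewrite horner_sum; apply: eq_bigr => I _; rewrite hornerZ hornerXn mulrC.
Qed.

(** The Euler operator multiplies the coefficient of ['X^k] by [k], so each application raises the
    moment by one. *)
Lemma deriv_hard_core_poly f :
  'X * (hard_core_poly f)^`() = hard_core_poly (fun I => #|I|%:R * f I).
Proof.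
rewrite /hard_core_poly raddf_sum mulr_sumr; apply: eq_bigr => I _.
rewrite /= derivZ derivXn -scalerAr mulrnAr mulr_natl -scalerMnr scalerMnl.
by case: #|I| => [|k]; rewrite ?mulr0n ?scale0r // -exprS.
Qed.

(** The empty set and all singletons are independent in every graph; only the sets of size at least
    2 depend on the edges. *)
Lemma hard_core_sum_card lam (g : nat -> R) : S lam (fun I => g #|I|)
  = g 0 + #|G|%:R * lam * g 1
    + \sum_(I : {set G} | independent I && (1 < #|I|)%N) lam ^+ #|I| * g #|I|.
Proof.
rewrite /S (bigID (fun I : {set G} => (#|I| <= 1)%N)) /=.
congr (_ + _); last by apply: eq_bigl => I; rewrite ltnNge.
rewrite (bigD1 finset.set0) /=; last by rewrite independent_small cards0.
rewrite cards0 expr0 mul1r; congr (_ + _).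
rewrite -[X in X%:R]bin1 -card_draws -mulrA mulr_natl -sumr_const.
apply: eq_big => [I|I /andP[/andP[_ I1] I0]]; rewrite ?inE -?cards_eq0.
  have := @independent_small G I.
  by case: #|I| => [|[|k]] /=; rewrite ?andbF // => ->.
by move: I1 I0; rewrite -cards_eq0; case: #|I| => [|[|]].
Qed.

Lemma hard_core_sum_complete lam (g : nat -> R) :
  (forall x y : G, adj x y = (x != y)) ->
  S lam (fun I => g #|I|) = g 0 + #|G|%:R * lam * g 1.
Proof.
move=> Gcomplete; rewrite hard_core_sum_card big_pred0 ?addr0 // => I.
apply/negbTE/negP => /andP[/forall_inP iI]; rewrite ltnNge => /negP[].
apply/card_le1_eqP => x y xI yI.
by have /forall_inP/(_ _ yI) := iI x xI; rewrite Gcomplete negbK => /eqP.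
Qed.

(** * Inequalities at positive fugacity *)

Section Positive.
Variable lam : R.
Hypothesis lam0 : 0 < lam.

Let p : R := independence_poly G lam.
Let s1 : R := S lam (fun I => #|I|%:R).
Let s2 : R := S lam (fun I => #|I|%:R ^+ 2).

Lemma independence_polyE : p = 1 + #|G|%:R * lam
  + \sum_(I : {set G} | independent I && (1 < #|I|)%N) lam ^+ #|I|.
Proof.
rewrite /p -hard_core_sum_one (hard_core_sum_card lam (fun=> 1)) mulr1.
by congr (_ + _); apply: eq_bigr => I _; rewrite mulr1.
Qed.

Lemma independence_poly_ge : 1 + #|G|%:R * lam <= p.
Proof.
by rewrite independence_polyE lerDl sumr_ge0 // => I _; rewrite exprn_ge0 ?ltW.
Qed.

(** Two distinct non-adjacent vertices would add a term [lam ^+ 2 > 0]. *)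
Lemma independence_poly_complete_eq :
  p = 1 + #|G|%:R * lam -> forall x y : G, adj x y = (x != y).
Proof.
move=> pE x y; have [<-|xy] := eqVneq x y; first by rewrite adj_irr.
apply/negbNE/negP => /independent_pair ixy.
suff : 1 + #|G|%:R * lam < p by rewrite pE ltxx.
rewrite independence_polyE ltrDl (bigD1 [set x; y]) ?ixy ?cards2 ?xy //=.
by rewrite ltr_wpDr ?exprn_gt0 // sumr_ge0 // => I _; rewrite exprn_ge0 ?ltW.
Qed.

Lemma independence_poly_gt0 : 0 < p.
Proof.
by apply: lt_le_trans independence_poly_ge; rewrite ltr_wpDr // mulr_ge0 // ltW.
Qed.

Lemma hard_core_mean_ge : p - 1 <= s1.
Proof.
rewrite independence_polyE /s1 (hard_core_sum_card lam (fun k => k%:R)).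
rewrite mulr1 add0r addrAC [1 + _]addrC addrK lerD2l; apply: ler_sum => I /andP[_ I1].
by apply: ler_peMr; [rewrite exprn_ge0 // ltW | rewrite ler1n ltnW].
Qed.

Lemma hard_core_second_moment_ge :
  s1 * p <= (1 + #|G|%:R * lam) * (s2 * p - s1 ^+ 2).
Proof.
set n : R := #|G|%:R; set k := 1 + n * lam.
have k0 : 0 < k by rewrite /k ltr_wpDr // mulr_ge0 ?ler0n ?ltW.
pose U (I : {set G}) : R := #|addable I|%:R; pose X (I : {set G}) : R := #|I|%:R.
have s1U : s1 = lam * S lam U.
  transitivity (S lam (fun I => X I * 1)).
    by apply: eq_bigr => I _; rewrite mulr1.
  rewrite (hard_core_sum_switch lam (fun=> 1)); congr (_ * _).
  by apply: eq_bigr => I _; rewrite mulr1.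
have s2UX : s2 = s1 + lam * S lam (fun I => U I * X I).
  transitivity (lam * S lam (fun I => U I + U I * X I)); last first.
    by rewrite hard_core_sumD mulrDr -s1U.
  transitivity (S lam (fun I => X I * X I)).
    by apply: eq_bigr => I _; rewrite -expr2.
  (* The switch turns the second factor [X] into [X + 1], which yields the extra term
     [lam * S lam U = s1]. *)
  rewrite (hard_core_sum_switch lam (fun k => k%:R)).
  by congr (_ * _); apply: eq_bigr => I _; rewrite /U /X -natr1; ring.
have UX0 : 0 <= S lam (fun I => U I * X I).
  by apply: hard_core_sum_ge0 => // I; rewrite mulr_ge0 ?ler0n.
have UU : lam * S lam (fun I => U I ^+ 2) <= n * s1.
  rewrite s1U mulrCA ler_pM2l // -hard_core_sumZ.
  apply: ler_hard_core_sum => // I; rewrite expr2 ler_wpM2r ?ler0n //.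
  by rewrite ler_nat max_card.
(* [a X + b U + c = p k ((X - E X) - (X - lam U) / k)], the Cauchy-Schwarz
   residual cleared of denominators. *)
pose a := (k - 1) * p; pose b := p * lam; pose c := - (k * s1).
have := @hard_core_sum_ge0 lam (fun I => (a * X I + b * U I + c) ^+ 2) lam0
  (fun I => sqr_ge0 _).
have -> : S lam (fun I => (a * X I + b * U I + c) ^+ 2) =
    a ^+ 2 * s2 + b ^+ 2 * S lam (fun I => U I ^+ 2) + c ^+ 2 * p
    + 2 * a * b * S lam (fun I => U I * X I) + 2 * a * c * s1
    + 2 * b * c * S lam U.
  rewrite /p -hard_core_sum_one -!hard_core_sumZ -!hard_core_sumD.
  by apply: eq_bigr => I _; congr (_ * _); rewrite /X; ring.
move=> Q0.
have p0 := independence_poly_gt0.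
rewrite -(ler_pM2l (mulr_gt0 k0 p0)) -subr_ge0.
apply: (le_trans Q0); rewrite -subr_ge0.
(* What remains is [p ^+ 3] times the slack in [E Y^2 <= k E X], nonnegative by [UU] and [UX0]. *)
rewrite [X in 0 <= X](_ : _ = p ^+ 2 * lam * (n * s1 - lam * S lam (fun I => U I ^+ 2))
  + p ^+ 2 * lam * S lam (fun I => U I * X I)).
  by rewrite addr_ge0 // !mulr_ge0 ?subr_ge0 // ltW // exprn_gt0.
by rewrite /a /b /c s2UX s1U /k; ring.
Qed.

End Positive.

(** * From derivatives to moments, and the variance bound *)

Lemma variance_fractionE lam
    (p := independence_poly G lam)
    (s1 := S lam (fun I => #|I|%:R))
    (s2 := S lam (fun I => #|I|%:R ^+ 2)) : 0 < lam ->
  variance_fraction G lam = #|G|%:R^-1 * ((s2 * p - s1 ^+ 2) / p ^+ 2).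
Proof.
move=> lam0; pose q := hard_core_poly (fun=> 1).
pose r := 'X * q^`().
have qE x : q.[x] = independence_poly G x.
  by rewrite horner_hard_core_poly hard_core_sum_one.
have rE : r.[lam] = s1.
  rewrite /r deriv_hard_core_poly horner_hard_core_poly.
  by apply: eq_bigr => I _; rewrite mulr1.
have dqE : lam * q^`().[lam] = s1 by rewrite -rE hornerM hornerX.
have drE : lam * r^`().[lam] = s2.
  transitivity ('X * r^`()).[lam]; first by rewrite hornerM hornerX.
  rewrite /r !deriv_hard_core_poly.
  by rewrite horner_hard_core_poly; apply: eq_bigr => I _; rewrite mulr1 -expr2.
have occE x : 0 < x -> occupancy_fraction G x = #|G|%:R^-1 * (r.[x] / q.[x]).
  move=> x0; have qx0 : 0 < q.[x] by rewrite qE independence_poly_gt0.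
  rewrite /occupancy_fraction derive1E.
  have -> : free_energy_density G = #|G|%:R^-1 \*: (@ln R \o horner q).
    by apply/funext => y; rewrite /free_energy_density /= qE.
  have dln : is_derive q.[x] 1 (@ln R) q.[x]^-1 by exact: is_derive1_ln.
  by rewrite derive_val hornerM hornerX /GRing.scale /=; ring.
rewrite /variance_fraction derive1E.
(* [occE] holds only for positive arguments, which suffices on a neighbourhood of [lam]. *)
rewrite (@near_eq_derive _ _ _ _ (#|G|%:R^-1 \*: (horner r * (fun x => q.[x]^-1)))); last first.
  by near=> x; rewrite occE //; near: x; exact: lt_nbhsr.
have q0 : q.[lam] != 0 by rewrite qE gt_eqF // independence_poly_gt0.
have dV := is_deriveV q0 (is_derive_poly q lam).
rewrite derive_val /GRing.scale /= rE -dqE -drE /p -qE.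
(* [G] may be empty here; generalising the inverse spares [field] the condition [#|G| != 0]. *)
by move: (#|G|%:R^-1) => c; field.
Unshelve. all: by end_near. Qed.

Lemma variance_fraction_complete lam : 0 < lam ->
  (forall x y : G, adj x y = (x != y)) ->
  variance_fraction G lam = #|G|%:R^-1 * (#|G|%:R * lam / (1 + #|G|%:R * lam) ^+ 2).
Proof.
move=> lam0 Gcomplete; rewrite variance_fractionE // -hard_core_sum_one.
rewrite (hard_core_sum_complete lam (fun k => k%:R) Gcomplete).
rewrite (hard_core_sum_complete lam (fun k => k%:R ^+ 2) Gcomplete).
rewrite (hard_core_sum_complete lam (fun=> 1) Gcomplete).
by congr (_ * (_ / _ ^+ 2)); ring.
Qed.

(** The two moment bounds give [(p - 1) / (p * k)], which splits as [(k - 1) / k ^+ 2] plus an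
    excess; the excess is kept because it decides the equality case. *)
Lemma variance_fraction_ge lam
    (p := independence_poly G lam) (k := 1 + #|G|%:R * lam) : 0 < lam ->
  #|G|%:R^-1 * (#|G|%:R * lam / k ^+ 2 + (p - k) / (p * k ^+ 2))
    <= variance_fraction G lam.
Proof.
move=> lam0; rewrite variance_fractionE // ler_wpM2l ?invr_ge0 ?ler0n //.
have k0 : 0 < k by rewrite /k ltr_wpDr // mulr_ge0 ?ler0n ?ltW.
have p0 : 0 < p by exact: independence_poly_gt0.
have := hard_core_second_moment_ge lam0; rewrite -/p -/k.
have := hard_core_mean_ge lam0; rewrite -/p.
set s1 := S _ _; set D := _ - _ => s1_ge D_ge.
rewrite ler_pdivlMr ?exprn_gt0 // -(ler_pM2l k0); apply: le_trans D_ge.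
have -> : k * ((#|G|%:R * lam / k ^+ 2 + (p - k) / (p * k ^+ 2)) * p ^+ 2) = (p - 1) * p.
  rewrite (_ : #|G|%:R * lam = k - 1); last by rewrite /k; ring.
  by field; rewrite !gt_eqF.
by rewrite ler_pM2r.
Qed.

End HardCoreMoments.

(** * Comparison with the complete graph *)

Theorem corollary1p4 (R : realType) (n : nat) (hn : (1 <= n)%N)
    (G : sgraph) (hG : #|G| = n) (lam : R) (hlam : 0 < lam) :
  [/\ variance_fraction (complete_graph n) lam <= variance_fraction G lam,
      variance_fraction (complete_graph n) lam
        = lam / (1 + n%:R * lam) ^+ 2
    & variance_fraction G lam = variance_fraction (complete_graph n) lam
        <-> isomorphic G (complete_graph n)].
Proof.
have n0 : 0 < n%:R :> R by rewrite ltr0n.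
set k := 1 + n%:R * lam.
have k0 : 0 < k by rewrite /k ltr_wpDr // mulr_ge0 ?ler0n ?ltW.
have VK (H : sgraph) : #|H| = n -> (forall x y : H, adj x y = (x != y)) ->
    variance_fraction H lam = lam / k ^+ 2.
  move=> Hn Hcomplete; rewrite variance_fraction_complete // Hn -/k.
  by field; rewrite !gt_eqF.
have VKn : variance_fraction (complete_graph n) lam = lam / k ^+ 2.
  by apply: VK; rewrite //= card_ord.
set p := independence_poly G lam.
have p0 : 0 < p by exact: independence_poly_gt0.
have pk : k <= p by rewrite /k -hG independence_poly_ge.
have VG : lam / k ^+ 2 + (p - k) / (n%:R * p * k ^+ 2) <= variance_fraction G lam.
  apply: le_trans (variance_fraction_ge G hlam); rewrite hG -/k -/p.
  by rewrite le_eqVlt; apply/orP; left; apply/eqP; field; rewrite !gt_eqF.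
have pk2 : 0 < n%:R * p * k ^+ 2 by rewrite !mulr_gt0 // exprn_gt0.
split; rewrite ?VKn //.
  by apply: le_trans VG; rewrite lerDl divr_ge0 ?subr_ge0 // ltW.
split=> [VGE|/(isomorphic_completeP hG) /VK -> //].
apply/(isomorphic_completeP hG).
apply: (independence_poly_complete_eq hlam); rewrite hG -/k -/p.
apply/le_anti; rewrite pk andbT.
(* Equality leaves no room for the excess in [VG], hence [p <= k]. *)
by move: VG; rewrite VGE gerDl ler_pdivrMr // mul0r subr_le0.
Qed.
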